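(* Let $N\geq 2$, $1\leq k<N$ be integers and assume $0<p<\frac 2k$. Then for any uniformly continuous, nonnegative and nontrivial $u_0:\mathbb R^N\to\mathbb R$, the solution of $$\partial_t u=\mathcal P_k^+ u+u^{1+p}\ \text{ in }(0,+\infty)\times\mathbb R^N,\qquad u(0,\cdot)=u_0,$$ blows up in finite time.
   Context: For $u:\mathbb R^N\to\mathbb R$, let $\lambda_1(D^2u)\leq\cdots\leq\lambda_N(D^2u)$ be the eigenvalues of the Hessian $D^2u$ and $\mathcal P_k^+ u:=\sum_{i=N-k+1}^N\lambda_i(D^2u)$. For uniformly continuous initial data the Cauchy problem is locally well-posed in time in the viscosity sense (with a comparison principle); ''blows up in finite time'' means the viscosity solution does not exist globally in time (it cannot be continued for all $t>0$). *)

(* Defs.v *)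
From HB Require Import structures.
From mathcomp Require Import all_boot all_order all_algebra.
From mathcomp Require Import all_classical all_reals all_analysis.
From Stdlib Require ClassicalEpsilon.
Set Implicit Arguments. Unset Strict Implicit. Unset Printing Implicit Defensive.
Import Order.TTheory GRing.Theory Num.Theory.
Import numFieldNormedType.Exports.
Local Open Scope ring_scope.

Section Defs.
Variable R : realType.
Variable N : nat.

(* space points: row vectors 'rV[R]_N, with the (max) norm of mathcomp-analysis *)
Definition evec (i : 'I_N) : 'rV[R]_N := delta_mx 0 i.

(* spectrum: the nondecreasing list of the N eigenvalues (with multiplicity),
   i.e. the sorted real roots of the characteristic polynomial; for real
   symmetric matrices such a list exists and is unique. *)
Definition is_spectrum (X : 'M[R]_N) (s : seq R) : Prop :=
  size s = N /\ sorted <=%R s /\ char_poly X = \prod_(a <- s) ('X - a%:P).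

Definition eigs (X : 'M[R]_N) : seq R :=
  ClassicalEpsilon.epsilon (inhabits [::]) (is_spectrum X).

Definition Pkplus (k : nat) (X : 'M[R]_N) : R :=
  \sum_(N - k <= i < N) nth 0 (eigs X) i.

Definition jcont (f : R -> 'rV[R]_N -> R) : Prop :=
  forall t x e, 0 < e -> exists2 d, 0 < d & forall s y,
    `|s - t| < d -> `|y - x| < d -> `|f s y - f t x| < e.

Definition dtime (phi : R -> 'rV[R]_N -> R) (t : R) (x : 'rV[R]_N) : R :=
  derive1 (fun s => phi s x) t.

Definition dx (phi : R -> 'rV[R]_N -> R) (j : 'I_N) (t : R) (x : 'rV[R]_N) : R :=
  'D_(evec j) (phi t) x.

Definition dxx (phi : R -> 'rV[R]_N -> R) (i j : 'I_N) (t : R) (x : 'rV[R]_N) : R :=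
  'D_(evec i) (fun y => dx phi j t y) x.

Definition hess (phi : R -> 'rV[R]_N -> R) (t : R) (x : 'rV[R]_N) : 'M[R]_N :=
  \matrix_(i, j) dxx phi i j t x.

Definition C12 (phi : R -> 'rV[R]_N -> R) : Prop :=
  [/\ forall t x, derivable (fun s => phi s x) t 1,
      forall t x j, derivable (phi t) x (evec j),
      forall t x i j, derivable (fun y => dx phi j t y) x (evec i),
      jcont phi /\ jcont (dtime phi) &
      forall i j, jcont (dx phi j) /\ jcont (dxx phi i j)].

Definition nonlin (p : R) (v : R) : R := (Num.max v 0) `^ (1 + p).

Definition loc_max_at (w : R -> 'rV[R]_N -> R) (t : R) (x : 'rV[R]_N) : Prop :=
  exists2 r, 0 < r & forall s y, 0 < s -> `|s - t| < r -> `|y - x| < r ->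
    w s y <= w t x.

Definition loc_min_at (w : R -> 'rV[R]_N -> R) (t : R) (x : 'rV[R]_N) : Prop :=
  exists2 r, 0 < r & forall s y, 0 < s -> `|s - t| < r -> `|y - x| < r ->
    w t x <= w s y.

Definition visc_sol (k : nat) (p : R) (u : R -> 'rV[R]_N -> R) : Prop :=
  (forall t x phi, 0 < t -> C12 phi ->
     loc_max_at (fun s y => u s y - phi s y) t x ->
     dtime phi t x <= Pkplus k (hess phi t x) + nonlin p (u t x)) /\
  (forall t x phi, 0 < t -> C12 phi ->
     loc_min_at (fun s y => u s y - phi s y) t x ->
     Pkplus k (hess phi t x) + nonlin p (u t x) <= dtime phi t x).

Definition unif_cont (u0 : 'rV[R]_N -> R) : Prop :=
  forall e, 0 < e -> exists2 d, 0 < d & forall x y,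
    `|x - y| < d -> `|u0 x - u0 y| < e.

Definition unif_cont_strip (u : R -> 'rV[R]_N -> R) (T : R) : Prop :=
  forall e, 0 < e -> exists2 d, 0 < d & forall t s x y,
    0 <= t -> t <= T -> 0 <= s -> s <= T ->
    `|t - s| < d -> `|x - y| < d -> `|u t x - u s y| < e.

(* a global-in-time viscosity solution of the Cauchy problem, in the
   well-posedness class (continuous, uniformly continuous on each strip) *)
Definition global_solution (k : nat) (p : R) (u0 : 'rV[R]_N -> R)
    (u : R -> 'rV[R]_N -> R) : Prop :=
  [/\ forall x, u 0 x = u0 x,
      forall T, 0 < T -> unif_cont_strip u T &
      visc_sol k p u].

End Defs.

(* Main.v *)
Require Import Defs.
From HB Require Import structures.
From mathcomp Require Import all_boot all_order all_algebra.
From mathcomp Require Import all_classical all_reals all_analysis.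
From mathcomp Require Import ring lra zify.
From Stdlib Require ClassicalEpsilon.
Import Order.TTheory GRing.Theory Num.Theory.
Import numFieldNormedType.Exports.
Set Implicit Arguments. Unset Strict Implicit. Unset Printing Implicit Defensive.
Local Open Scope classical_set_scope.
Local Open Scope ring_scope.

(** Only the supersolution property is used. On radial functions [P_k^+] dominates [f'' + (k - 1) f' / r], the radial Laplacian of dimension [k], so a positive bump spreads at least like the [k]-dimensional heat kernel: for [k/2 < al < 1/p] and suitable [nu] and odd [m], [A T^-al (1 - nu |x - x0|^2 / T)^m] with [T = th + t] is a subsolution of the linear equation. Hence at a late time [u >= c T^-al] on a ball of radius comparable to [sqrt T]. Since [al < 1/p], this is, relative to that radius, eventually large enough to lie above a paraboloid [G(t) - B(t) |x - x0|^2] which shrinks to a point with [G] tending to infinity in finite time and is a subsolution where it is positive. Comparison forces [u] to be unbounded near that time. *)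

(** * Spectrum of a scalar matrix plus a rank-one matrix *)

(** For [al = k / 2] the natural profile would be the Gaussian [exp (- |x - x0|^2 / (4 T))],
    positive everywhere. The surplus [al > k / 2] pays for replacing it by the power
    [(1 - nu |x - x0|^2 / T)^m], where [m nu = al / (2 k)] takes the place of [1 / 4]. A bounded
    positivity set is what makes comparison elementary: outside it [u >= 0] suffices, so the
    argument runs on a compact cylinder and no growth bound on [u] enters. Nonnegativity of [u] is
    not part of the notion of solution and has to be derived from that of [u0]. One of the two
    compared functions is always explicit, so variables are not doubled: a test function touching
    the explicit one from below is enough. The reaction is only locally Lipschitz, but it is
    compared only where [u < w], and there [0 <= u <= w]; a bound on the explicit [w] is therefore
    all that is required. *)

Lemma det_scalar_sub_rank1 (D : idomainType) (n : nat) (c : D)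
    (x : 'rV[D]_n) (y : 'cV[D]_n) : c != 0 ->
  \det (c%:M - y *m x) * c = (c - (x *m y) 0 0) * c ^+ n.
Proof.
move=> c0.
pose M : 'M[D]_(1 + n) := block_mx 1%:M x y c%:M.
have M1 : \det M = \det (c%:M - y *m x).
  have -> : M = block_mx 1%:M 0 y 1%:M *m block_mx 1%:M x 0 (c%:M - y *m x).
    by rewrite mulmx_block !(mul1mx, mulmx1, mul0mx, mulmx0, addr0, add0r) addrC subrK.
  by rewrite det_mulmx det_lblock det_ublock !det1 !mul1r.
rewrite -M1.
(* Eliminating [y] by columns would divide by [c]; scaling the first column by [c] instead keeps the
   computation inside the ring. *)
have -> : \det M * c = \det (M *m block_mx c%:M 0 (- y) 1%:M).
  by rewrite det_mulmx det_lblock det1 mulr1 det_scalar1.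
rewrite mulmx_block !(mul1mx, mulmx1, mul0mx, mulmx0, addr0, add0r).
rewrite mul_mx_scalar mul_scalar_mx scalerN subrr det_ublock det_scalar.
by congr (_ * _); rewrite det_mx11 mulmxN !mxE mulr1n.
Qed.

Lemma char_poly_scalar_add_rank1 (D : idomainType) (n : nat) (a b : D) (d : 'rV[D]_n.+1) :
  char_poly (a%:M + b *: (d^T *m d)) =
  ('X - a%:P) ^+ n * ('X - (a + b * \sum_j d 0 j ^+ 2)%:P).
Proof.
have Xa0 : 'X - a%:P != 0 :> {poly D} by rewrite polyXsubC_eq0.
apply: (mulIf Xa0); rewrite /char_poly /char_poly_mx.
have -> : 'X%:M - map_mx polyC (a%:M + b *: (d^T *m d)) =
    ('X - a%:P)%:M - (b%:P *: (map_mx polyC d)^T) *m map_mx polyC d.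
  rewrite map_mxD map_scalar_mx map_mxZ map_mxM map_trmx -scalemxAl.
  by rewrite raddfB /= opprD addrA.
rewrite det_scalar_sub_rank1// exprSr mulrA [_ * _ ^+ n]mulrC; congr (_ * _ * _).
rewrite polyCD opprD addrA; congr (_ - _).
rewrite -scalemxAr mxE polyCM; congr (_ * _).
rewrite mxE rmorph_sum; apply: eq_bigr => j _.
by rewrite !mxE expr2 rmorphM.
Qed.

Lemma is_spectrum_uniq (R : realType) (N : nat) (X : 'M[R]_N) (s s' : seq R) :
  is_spectrum X s -> is_spectrum X s' -> s = s'.
Proof.
move=> [_ [ss Xs]] [_ [ss' Xs']].
apply: (sorted_eq le_trans le_anti ss ss').
by apply: prod_XsubC_eq; rewrite -Xs.
Qed.

Lemma eigsE (R : realType) (N : nat) (X : 'M[R]_N) (s : seq R) :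
  is_spectrum X s -> eigs X = s.
Proof.
move=> Xs; apply: (is_spectrum_uniq _ Xs).
by apply: ClassicalEpsilon.epsilon_spec; exists s.
Qed.

(** Since [b >= 0], the simple eigenvalue [a + b |d|^2] is the largest, so it is always among the
    [k] selected ones; the other [k - 1] equal [a]. *)
Lemma Pkplus_scalar_add_rank1 (R : realType) (N k : nat) (a b : R) (d : 'rV[R]_N) :
  (1 <= k)%N -> (k <= N)%N -> 0 <= b ->
  Pkplus k (a%:M + b *: (d^T *m d)) = k%:R * a + b * \sum_j d 0 j ^+ 2.
Proof.
case: N d => [|n] d k1 kN b0; first by case: k k1 kN.
set q := \sum_j _; have q0 : 0 <= q by apply: sumr_ge0 => j _; exact: sqr_ge0.
have /eigsE E : is_spectrum (a%:M + b *: (d^T *m d)) (rcons (nseq n a) (a + b * q)).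
  split; [by rewrite size_rcons size_nseq | split].
    have ab : a <= a + b * q by rewrite lerDl mulr_ge0.
    move: (a + _) ab => y ay; case: n {d q q0 k1 kN} => //= n.
    by elim: n => [|n IH] /=; rewrite ?ay ?lexx.
  rewrite char_poly_scalar_add_rank1 -cats1 big_cat /= big_seq1; congr (_ * _).
  by rewrite big_nseq; elim: n {d q q0 k1 kN} => //= n IH; rewrite exprS IH.
rewrite /Pkplus E big_nat_recr /=; last by rewrite subSn// ltnS leq_subr || lia.
rewrite nth_rcons size_nseq ltnn eqxx addrA; congr (_ + _).
rewrite (eq_big_nat _ _ (F2 := fun=> a)); last first.
  by move=> i /andP[_ i_n]; rewrite nth_rcons size_nseq i_n nth_nseq i_n.
rewrite sumr_const_nat (_ : n - (n.+1 - k) = k.-1)%N; last by lia.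
by rewrite -mulrSr prednK // mulr_natl.
Qed.

(** * Test functions *)

Section Calculus.
Variable R : realType.

Section IsDerive.
Variables (V : normedModType R) (x v : V) (f g : V -> R) (df dg : R).

Lemma is_derive_addf : is_derive x v f df -> is_derive x v g dg ->
  is_derive x v (fun y => f y + g y) (df + dg).
Proof. exact: is_deriveD. Qed.

Lemma is_derive_mulf : is_derive x v f df -> is_derive x v g dg ->
  is_derive x v (fun y => f y * g y) (f x * dg + g x * df).
Proof. exact: is_deriveM. Qed.

Lemma is_derive_expf (n : nat) : is_derive x v f df ->
  is_derive x v (fun y => f y ^+ n) (n%:R * f x ^+ n.-1 * df).
Proof.
move=> fx; have -> : (fun y => f y ^+ n) = f ^+ n by apply/funext => y; rewrite fctE.
exact: is_deriveX.
Qed.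

Lemma is_derive_scalef (c : R) : is_derive x v f df ->
  is_derive x v (fun y => c * f y) (c * df).
Proof. exact: is_deriveZ. Qed.

Lemma is_derive_addcf (c : R) : is_derive x v f df ->
  is_derive x v (fun y => c + f y) df.
Proof.
by move=> fx; rewrite -[df]add0r; apply: is_deriveD; exact: is_derive_cst.
Qed.

End IsDerive.

Section Continuity.
Variables (T : topologicalType) (f g : T -> R).

Lemma continuous_addf : continuous f -> continuous g ->
  continuous (fun z => f z + g z).
Proof. by move=> cf cg z; apply: cvgD; [exact: cf | exact: cg]. Qed.

Lemma continuous_mulf : continuous f -> continuous g ->
  continuous (fun z => f z * g z).
Proof. by move=> cf cg z; apply: cvgM; [exact: cf | exact: cg]. Qed.

Lemma continuous_oppf : continuous f -> continuous (fun z => - f z).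
Proof. by move=> cf z; apply: cvgN; exact: cf. Qed.

End Continuity.

Lemma continuous_expf (T : topologicalType) (f : T -> R) (n : nat) : continuous f -> continuous (fun z => f z ^+ n).
Proof.
move=> cf; elim: n => [|n IH].
  by under eq_fun do rewrite expr0; exact: cst_continuous.
rewrite (_ : (fun z => _) = fun z => f z * f z ^+ n); first exact: (continuous_mulf cf IH).
by apply/funext => z; rewrite exprS.
Qed.

Lemma continuous_sumf (T : topologicalType) (I : Type) (r : seq I) (f : I -> T -> R) :
  (forall i, continuous (f i)) -> continuous (fun z => \sum_(i <- r) f i z).
Proof.
move=> cf; elim: r => [|i r IH].
  by under eq_fun do rewrite big_nil; exact: cst_continuous.
rewrite (_ : (fun z => _) = fun z => f i z + \sum_(j <- r) f j z).
  exact: (continuous_addf (cf i) IH).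
by apply/funext => z; rewrite big_cons.
Qed.

Variable N : nat.
Implicit Types (x y : 'rV[R]_N) (t s : R) (phi : R -> 'rV[R]_N -> R).

Lemma continuous_jcont phi :
  continuous (fun z : R * 'rV[R]_N => phi z.1 z.2) -> jcont phi.
Proof.
move=> cphi t x e e0; have /cvgrPdist_lt/(_ _ e0)/nbhs_ballP[d d0 dP] := cphi (t, x).
exists d => // s y st yx; rewrite distrC; apply: (dP (s, y)).
by split; rewrite /= -ball_normE /= distrC.
Qed.

Lemma jcont_continuous phi :
  jcont phi -> continuous (fun z : R * 'rV[R]_N => phi z.1 z.2).
Proof.
move=> cphi [t x]; apply/cvgrPdist_lt => e e0; have [d d0 dP] := cphi t x e e0.
apply/(@nbhs_ballP R (R * 'rV[R]_N)%type); exists d => //= -[s y] [/=].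
by rewrite -!ball_normE /= => ts xy; rewrite distrC; apply: dP; rewrite distrC.
Qed.

Lemma continuous_fst_comp (f : R -> R) :
  continuous f -> continuous (fun z : R * 'rV[R]_N => f z.1).
Proof. by move=> cf z; apply: continuous_comp; [exact: cvg_fst | exact: cf]. Qed.

Lemma continuous_snd_comp (f : 'rV[R]_N -> R) :
  continuous f -> continuous (fun z : R * 'rV[R]_N => f z.2).
Proof. by move=> cf z; apply: continuous_comp; [exact: cvg_snd | exact: cf]. Qed.

(** The norm on row vectors is the max norm, whereas radial barriers must be Euclidean for their
    Hessian to be scalar plus rank one. *)
Definition sqdist (x0 x : 'rV[R]_N) : R := \sum_j (x - x0) 0 j ^+ 2.

Lemma sqdist_ge0 x0 x : 0 <= sqdist x0 x.
Proof. by apply: sumr_ge0 => j _; exact: sqr_ge0. Qed.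

Lemma normsq_le_sqdist (x0 : 'rV[R]_N) x : `|x - x0| ^+ 2 <= sqdist x0 x.
Proof.
have h (r : R) : (forall j, `|(x - x0) 0 j| <= r) -> 0 <= r -> `|x - x0| <= r.
  move=> hr r0; rewrite /Num.Def.normr /= mx_normrE bigmax_le// => -[i j] _ /=.
  by rewrite ord1.
rewrite -(@sqr_sqrtr _ (sqdist x0 x)) ?sqdist_ge0// ler_pXn2r ?nnegrE ?sqrtr_ge0//.
apply: h; last exact: sqrtr_ge0.
move=> j; rewrite -sqrtr_sqr ler_wsqrtr// /sqdist (bigD1 j)//= lerDl.
by apply: sumr_ge0 => i _; exact: sqr_ge0.
Qed.

Lemma continuous_coordB (x0 : 'rV[R]_N) (j : 'I_N) : continuous (fun x => (x - x0) 0 j).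
Proof.
under eq_fun do rewrite !mxE.
by apply: continuous_addf; [exact: coord_continuous | exact: cst_continuous].
Qed.

Lemma continuous_sqdist (x0 : 'rV[R]_N) : continuous (sqdist x0).
Proof.
by apply: continuous_sumf => j; apply: continuous_expf; exact: continuous_coordB.
Qed.

Lemma is_derive_coordB (x0 : 'rV[R]_N) x (i j : 'I_N) :
  is_derive x (evec R i) (fun y => (y - x0) 0 j) (i == j)%:R.
Proof.
have E h : h^-1 *: ((((fun y => (y - x0) 0 j) \o shift x) (h *: evec R i)
    : R) - (x - x0) 0 j) = h^-1 * h * (i == j)%:R.
  rewrite /= /evec !mxE eqxx /= [j == i]eq_sym /GRing.scale /= -mulrA; congr (_ * _).
  ring.
have L : (fun h : R => h^-1 *: ((((fun y => (y - x0) 0 j) \o shift x) (h *: evec R i)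
    : R) - (x - x0) 0 j)) @ 0^' --> ((i == j)%:R : R).
  apply: cvg_near_cst; near=> h; rewrite E mulVf ?mul1r//.
  near: h; exact: nbhs_dnbhs_neq.
split; last exact: (cvg_lim _ L).
by apply/cvg_ex; exists (i == j)%:R.
Unshelve. all: by end_near. Qed.

Lemma is_derive_sqdist (x0 : 'rV[R]_N) x (i : 'I_N) :
  is_derive x (evec R i) (sqdist x0) (2 * (x - x0) 0 i).
Proof.
rewrite (_ : sqdist x0 = \sum_j (fun y => (y - x0) 0 j ^+ 2)); last first.
  by apply/funext => y; rewrite fct_sumE.
apply: is_derive_eq.
  by apply: is_derive_sum => j; apply: is_derive_expf; exact: is_derive_coordB.
rewrite (bigD1 i)//= big1 ?eqxx ?mulr1 ?addr0 ?expr1// => j ji.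
by rewrite eq_sym (negbTE ji) mulr0.
Qed.

End Calculus.

Section Profile.
Variables (R : realType) (N : nat) (x0 : 'rV[R]_N).
Variables (a b c a' b' c' : R -> R) (m : nat).
Hypothesis (Da : forall t : R, is_derive t 1 a (a' t)).
Hypothesis (Db : forall t : R, is_derive t 1 b (b' t)).
Hypothesis (Dc : forall t : R, is_derive t 1 c (c' t)).

(** One family for all barriers: [m = 1] gives paraboloids (the constant 1 from the power is then
    cancelled by a [-1] in [a]), and [a = 0] with [m] large gives the spreading bump. *)
Definition profile (t : R) (x : 'rV[R]_N) : R :=
  a t + b t * (1 - c t * sqdist x0 x) ^+ m.

Let Y (t : R) (x : 'rV[R]_N) : R := 1 - c t * sqdist x0 x.

Let dtimeE (t : R) x : is_derive t 1 (fun s => profile s x)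
  (a' t + (b t * (m%:R * Y t x ^+ m.-1 * (- c' t * sqdist x0 x)) + b' t * Y t x ^+ m)).
Proof.
apply: is_derive_addf.
have DY : is_derive t 1 (fun s => Y s x) (- c' t * sqdist x0 x).
  apply: is_derive_addcf.
  rewrite (_ : (fun y => _) = fun y => (- sqdist x0 x) * c y); last first.
    by apply/funext => y; rewrite mulNr mulrC.
  by rewrite mulNr mulrC -mulNr; exact: is_derive_scalef.
rewrite [b' t * _]mulrC.
exact: (is_derive_mulf (Db t) (is_derive_expf m DY)).
Qed.

Let DY t x i : is_derive x (evec R i) (Y t) (- c t * (2 * (x - x0) 0 i)).
Proof.
apply: is_derive_addcf.
rewrite (_ : (fun y => _) = fun y => (- c t) * sqdist x0 y); last first.
  by apply/funext => y; rewrite mulNr.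
by apply: is_derive_scalef; exact: is_derive_sqdist.
Qed.

Let dxE' t x j : is_derive x (evec R j) (profile t)
  (b t * (m%:R * Y t x ^+ m.-1 * (- c t * (2 * (x - x0) 0 j)))).
Proof.
by apply: is_derive_addcf; apply: is_derive_scalef; exact: (is_derive_expf m (DY t x j)).
Qed.

Let dxE j : dx profile j = fun t x =>
  (b t * (m%:R * - c t * 2)) * (Y t x ^+ m.-1 * (x - x0) 0 j).
Proof.
apply/funext => t; apply/funext => x; rewrite /dx (@derive_val _ _ _ _ _ _ _ (dxE' t x j)).
by ring.
Qed.

Let dxxE' t x i j : is_derive x (evec R i) (dx profile j t)
  ((b t * (m%:R * - c t * 2)) * (Y t x ^+ m.-1 * (i == j)%:R + (x - x0) 0 j *
    (m.-1%:R * Y t x ^+ m.-2 * (- c t * (2 * (x - x0) 0 i))))).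
Proof.
rewrite dxE; apply: is_derive_scalef.
exact: (is_derive_mulf (is_derive_expf m.-1 (DY t x i)) (is_derive_coordB x0 x i j)).
Qed.

Lemma dtime_profile t x : dtime profile t x =
  a' t + b' t * (1 - c t * sqdist x0 x) ^+ m
  - b t * c' t * sqdist x0 x * m%:R * (1 - c t * sqdist x0 x) ^+ m.-1.
Proof.
by rewrite /dtime derive1E (@derive_val _ _ _ _ _ _ _ (dtimeE t x)) /Y; ring.
Qed.

Lemma hess_profile t x : hess profile t x =
  (- 2 * b t * c t * m%:R * (1 - c t * sqdist x0 x) ^+ m.-1)%:M +
  (4 * b t * c t ^+ 2 * (m * m.-1)%:R * (1 - c t * sqdist x0 x) ^+ m.-2) *:
    ((x - x0)^T *m (x - x0)).
Proof.
apply/matrixP => i j; rewrite !mxE big_ord1 /dxx (@derive_val _ _ _ _ _ _ _ (dxxE' t x i j)).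
rewrite !mxE -mulr_natr /Y; ring.
Qed.

Lemma Pkplus_hess_profile (k : nat) t x : (1 <= k)%N -> (k <= N)%N ->
  0 <= b t * (m * m.-1)%:R * (1 - c t * sqdist x0 x) ^+ m.-2 ->
  Pkplus k (hess profile t x) =
  - 2 * k%:R * b t * c t * m%:R * (1 - c t * sqdist x0 x) ^+ m.-1 +
  4 * b t * c t ^+ 2 * (m * m.-1)%:R * (1 - c t * sqdist x0 x) ^+ m.-2 * sqdist x0 x.
Proof.
move=> k1 kN h; rewrite hess_profile Pkplus_scalar_add_rank1 //.
  by rewrite /sqdist; ring.
suff -> : 4 * b t * c t ^+ 2 * (m * m.-1)%:R * (1 - c t * sqdist x0 x) ^+ m.-2 =
  4 * c t ^+ 2 * (b t * (m * m.-1)%:R * (1 - c t * sqdist x0 x) ^+ m.-2).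
  by rewrite mulr_ge0// mulr_ge0// sqr_ge0.
by ring.
Qed.

Hypothesis (Ca : continuous a') (Cb : continuous b') (Cc : continuous c').

Let cont_of_derive (f f' : R -> R) : (forall t : R, is_derive t 1 f (f' t)) -> continuous f.
Proof.
move=> Df t; apply: differentiable_continuous; apply/derivable1_diffP.
by have [] := Df t.
Qed.

Let cY : continuous (fun z : R * 'rV[R]_N => Y z.1 z.2).
Proof.
apply: continuous_addf; first exact: cst_continuous.
apply: continuous_oppf; apply: continuous_mulf.
  exact: continuous_fst_comp (cont_of_derive Dc).
exact: continuous_snd_comp (@continuous_sqdist _ _ x0).
Qed.

Lemma C12_profile : C12 profile.
Proof.
have ca := continuous_fst_comp (N := N) (cont_of_derive Da).
have cb := continuous_fst_comp (N := N) (cont_of_derive Db).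
have cc := continuous_fst_comp (N := N) (cont_of_derive Dc).
have csq := continuous_snd_comp (@continuous_sqdist _ _ x0).
have cst (r : R) : continuous (fun _ : R * 'rV[R]_N => r) by exact: cst_continuous.
have coord j := continuous_snd_comp (@continuous_coordB _ _ x0 j).
split.
- by move=> t x; have [] := dtimeE t x.
- by move=> t x j; have [] := dxE' t x j.
- by move=> t x i j; have [] := dxxE' t x i j.
- split; apply: continuous_jcont.
    rewrite /profile; apply: continuous_addf => //; apply: continuous_mulf => //.
    exact: continuous_expf.
  rewrite (_ : (fun z => _) = fun z => a' z.1 + b' z.1 * Y z.1 z.2 ^+ m +
     (- (b z.1 * c' z.1 * sqdist x0 z.2 * m%:R * Y z.1 z.2 ^+ m.-1))); last first.
    by apply/funext => z; rewrite dtime_profile.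
  apply: continuous_addf; first apply: continuous_addf.
  + exact: continuous_fst_comp.
  + by apply: continuous_mulf; [exact: continuous_fst_comp | exact: continuous_expf].
  apply: continuous_oppf; apply: continuous_mulf; last exact: continuous_expf.
  apply: continuous_mulf; last exact: cst.
  apply: continuous_mulf => //; apply: continuous_mulf => //.
  exact: continuous_fst_comp.
move=> i j; split; apply: continuous_jcont.
  rewrite dxE; apply: continuous_mulf; last first.
    by apply: continuous_mulf; [exact: continuous_expf | exact: coord].
  apply: continuous_mulf => //; apply: continuous_mulf; last exact: cst.
  by apply: continuous_mulf; [exact: cst | exact: continuous_oppf].
rewrite (_ : (fun z => _) = fun z => (b z.1 * (m%:R * - c z.1 * 2)) *
   (Y z.1 z.2 ^+ m.-1 * (i == j)%:R + (z.2 - x0) 0 j *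
    (m.-1%:R * Y z.1 z.2 ^+ m.-2 * (- c z.1 * (2 * (z.2 - x0) 0 i))))); last first.
  by apply/funext => z; rewrite /dxx (@derive_val _ _ _ _ _ _ _ (dxxE' z.1 z.2 i j)).
apply: continuous_mulf.
  apply: continuous_mulf => //; apply: continuous_mulf; last exact: cst.
  by apply: continuous_mulf; [exact: cst | exact: continuous_oppf].
apply: continuous_addf; apply: continuous_mulf.
- exact: continuous_expf.
- exact: cst.
- exact: coord.
apply: continuous_mulf; apply: continuous_mulf.
- exact: cst.
- exact: continuous_expf.
- exact: continuous_oppf.
- by apply: continuous_mulf; [exact: cst | exact: coord].
Qed.

End Profile.

Section TimeShift.
Variables (R : realType) (N : nat).

Section Subc.
Variables (V : normedModType R) (f : V -> R) (c : R) (x v : V).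

Let quotientE : (fun h : R => h^-1 *: (((fun y => f y - c) \o shift x) (h *: v) - (f x - c))) =
  (fun h : R => h^-1 *: ((f \o shift x) (h *: v) - f x)).
Proof. by apply/funext => h; rewrite /= opprB addrA subrK. Qed.

Lemma derive_subc : 'D_v (fun y => f y - c) x = 'D_v f x.
Proof. by rewrite /derive quotientE. Qed.

Lemma derivable_subc : derivable f x v -> derivable (fun y => f y - c) x v.
Proof. by rewrite /derivable quotientE. Qed.

End Subc.

Variables (phi : R -> 'rV[R]_N -> R) (q q' : R -> R).
Hypothesis (C12phi : C12 phi).
Hypothesis (Dq : forall t : R, is_derive t 1 q (q' t)).

Let psi (t : R) (x : 'rV[R]_N) := phi t x - q t.

Let dxE j : dx psi j = dx phi j.
Proof. by apply/funext => t; apply/funext => x; rewrite /dx /psi derive_subc. Qed.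

Let dtimeE' (t : R) x : is_derive t 1 (fun s => psi s x) (dtime phi t x - q' t).
Proof.
have [D _ _ _ _] := C12phi.
by apply: is_deriveB; rewrite /dtime derive1E; exact/derivableP.
Qed.

Lemma dtime_sub_time t x : dtime psi t x = dtime phi t x - q' t.
Proof. by rewrite {1}/dtime derive1E (@derive_val _ _ _ _ _ _ _ (dtimeE' t x)). Qed.

Lemma hess_sub_time t x : hess psi t x = hess phi t x.
Proof. by apply/matrixP => i j; rewrite [LHS]mxE [RHS]mxE /dxx dxE. Qed.

Lemma C12_sub_time : continuous q' -> C12 psi.
Proof.
move=> cq'; have [D1 D2 D3 [J1 J2] J3] := C12phi.
have cq : continuous q.
  move=> t; apply: differentiable_continuous; apply/derivable1_diffP.
  by have [] := Dq t.
split.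
- by move=> t x; have [] := dtimeE' t x.
- by move=> t x j; apply: derivable_subc; exact: D2.
- by move=> t x i j; rewrite dxE; exact: D3.
- split; apply: continuous_jcont; rewrite /psi.
    apply: continuous_addf; first exact: jcont_continuous.
    by apply: continuous_oppf; exact: continuous_fst_comp.
  rewrite (_ : (fun z => _) = fun z => dtime phi z.1 z.2 + - q' z.1); last first.
    by apply/funext => z; rewrite dtime_sub_time.
  apply: continuous_addf; first exact: jcont_continuous.
  by apply: continuous_oppf; exact: continuous_fst_comp.
- move=> i j; have [J4 J5] := J3 i j; rewrite dxE; split; first exact: J4.
  rewrite (_ : dxx psi i j = dxx phi i j); first exact: J5.
  by apply/funext => t; apply/funext => x; rewrite /dxx dxE.
Qed.

End TimeShift.

(** * Comparison *)

Section Comparison.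
Variables (R : realType) (N : nat).
Implicit Types (x y : 'rV[R]_N) (t s : R).

(** The solution is controlled only for nonnegative times and the barriers may be singular later,
    while [jcont] speaks of all real times; freezing time outside [[a, b]] reconciles the two. *)
Definition clamp (a b t : R) : R := Num.max a (Num.min t b).

Lemma clamp_id (a b t : R) : a <= t <= b -> clamp a b t = t.
Proof. by move=> /andP[at_ tb]; rewrite /clamp (min_idPl tb) (max_idPr at_). Qed.

Lemma clamp_itv (a b t : R) : a <= b -> a <= clamp a b t <= b.
Proof. by move=> ab; rewrite /clamp le_max lexx /= ge_max ab ge_min lexx orbT. Qed.

Lemma clamp_lipschitz (a b s t : R) : a <= b -> `|clamp a b s - clamp a b t| <= `|s - t|.
Proof.
move=> ab; have st := ler_norm (s - t); have ts := ler_norm (- (s - t)).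
rewrite normrN in ts; rewrite /clamp !maxEle !minEle.
by case: (leP s b) => sb; case: (leP t b) => tb; rewrite ?ab;
  case: (leP a s) => h1; case: (leP a t) => h2;
  rewrite ?subrr ?normr0 ?normr_ge0// ler_norml; 
  apply/andP; split; lra.
Qed.

Lemma continuous_clamp (a b : R) : a <= b -> continuous (clamp a b).
Proof.
move=> ab t; apply/cvgrPdist_lt => e e0; near=> s.
by apply: le_lt_trans (clamp_lipschitz t s ab) _; near: s; exact: cvgr_dist_lt.
Unshelve. all: by end_near. Qed.

Lemma jcont_attains_max (f : R -> 'rV[R]_N -> R) (t0 t1 r : R) (x0 : 'rV[R]_N) :
  t0 <= t1 -> 0 <= r -> jcont f ->
  exists t x, [/\ t0 <= t <= t1, `|x - x0| <= r &
    forall s y, t0 <= s <= t1 -> `|y - x0| <= r -> f s y <= f t x].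
Proof.
move=> t01 r0 jf.
(* A closed ball of the max norm is a box, hence compact as a product of segments. *)
pose B := [set y : 'rV[R]_N | forall i, [set` `[x0 0 i - r, x0 0 i + r]] (y ord0 i)].
have BE y : B y <-> `|y - x0| <= r.
  split => [By|yr i].
    rewrite /Num.Def.normr /= mx_normrE bigmax_le// => -[i j] _ /=.
    by rewrite ord1; have := By j; rewrite /= in_itv /= !mxE ler_distl.
  rewrite /= in_itv /= -ler_distl; apply: le_trans yr.
  by rewrite [leRHS]/Num.Def.normr /= mx_normrE; apply: le_trans (le_bigmax _ _ (ord0, i)); rewrite /= !mxE.
have cQ : compact ([set` `[t0, t1]] `*` B).
  apply: compact_setX; first exact: segment_compact.
  by apply: (rV_compact (A := fun i => [set` `[x0 0 i - r, x0 0 i + r]])) => i; exact: segment_compact.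
have nQ : [set` `[t0, t1]] `*` B !=set0.
  by exists (t0, x0); split; [rewrite /= in_itv /= lexx | apply/BE; rewrite subrr normr0].
have cf := continuous_subspaceT (A := [set` `[t0, t1]] `*` B) (jcont_continuous jf).
have [[t x] /set_mem[/= tI /BE xB] H] := compact_EVT_max nQ cQ cf.
exists t, x; split; [by move: tI; rewrite ?in_itv | exact: xB | ].
by move=> s y sI /BE yB; apply: (H (s, y)); apply/mem_set; split => //=.
Qed.

(* The scaled excess [(w - u) exp (- n (t - t2))] is maximised over a compact cylinder; for [n] large the maximum is interior, also at the final time, and there [w - lambda exp (n (t - t2))] touches [u] from below. *)
Lemma comparison (k : nat) (p t0 t1 L r : R) (x0 : 'rV[R]_N) (u w : R -> 'rV[R]_N -> R) :
  visc_sol k p u -> 0 <= t0 ->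
  jcont (fun t x => u (clamp t0 t1 t) x) ->
  jcont (fun t x => w (clamp t0 t1 t) x) ->
  (forall x, w t0 x <= u t0 x) ->
  (forall t x, t0 <= t <= t1 -> r <= `|x - x0| -> w t x <= u t x) ->
  (forall t x, t0 < t < t1 -> u t x < w t x ->
    exists phi, [/\ C12 phi, phi t x = w t x,
      exists2 d, 0 < d & forall s y, `|s - t| < d -> `|y - x| < d -> phi s y <= w s y &
      dtime phi t x <=
        Pkplus k (hess phi t x) + nonlin p (u t x) + L * (w t x - u t x)]) ->
  forall t x, t0 <= t < t1 -> w t x <= u t x.
Proof.
move=> [_ usup] t00 ju jw w0 wr wsub t2 x2 /andP[t02 t21]; apply: contrapT => /negP.
rewrite -ltNge => uw2.
have t01 : t0 <= t1 by rewrite (le_trans t02)// ltW.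
have r0 : 0 <= r.
  rewrite leNgt; apply/negP => rlt; move: uw2; rewrite ltNge wr//.
    by rewrite t02 ltW.
  by rewrite (le_trans (ltW rlt)).
set e := w t2 x2 - u t2 x2; have e0 : 0 < e by rewrite subr_gt0.
have x2r : `|x2 - x0| <= r.
  by rewrite leNgt; apply/negP => /ltW h; move: uw2; rewrite ltNge wr// t02 ltW.
pose D t x := w (clamp t0 t1 t) x - u (clamp t0 t1 t) x.
have DE t x : t0 <= t <= t1 -> D t x = w t x - u t x.
  by move=> h; rewrite /D clamp_id.
have cD : continuous (fun z : R * 'rV[R]_N => D z.1 z.2).
  apply: continuous_addf; first exact: (jcont_continuous jw).
  by apply: continuous_oppf; exact: (jcont_continuous ju).
have [tW [xW [tWI xWr HW]]] := jcont_attains_max x0 t01 r0 (continuous_jcont cD).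
set W := D tW xW in HW.
have t2I : t0 <= t2 <= t1 by rewrite t02 ltW.
have t21' : 0 < t1 - t2 by rewrite subr_gt0.
have eW : e <= W by have := HW t2 x2 t2I x2r; rewrite DE.
have W0 : 0 < W := lt_le_trans e0 eW.
(* The first summand gives [L < n], contradicting [n * q t <= L * q t] at the contact point. The
   second makes [e * expR (n * (t1 - t2))] exceed the largest excess [W], which excludes a maximum
   at time [t1]. *)
pose n := `|L| + W / (e * (t1 - t2)).
have en : 0 < e * (t1 - t2) by rewrite mulr_gt0.
have nL : L < n by rewrite (le_lt_trans (ler_norm L))// ltrDl divr_gt0.
have nW : W < e * expR (n * (t1 - t2)).
  rewrite (@lt_le_trans _ _ (e * (1 + n * (t1 - t2))))//; last first.
    by rewrite ler_pM2l// expR_ge1Dx.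
  have : W / (e * (t1 - t2)) * (t1 - t2) * e = W.
    by field; rewrite !gt_eqF.
  have : 0 <= `|L| * (t1 - t2) * e by rewrite !mulr_ge0// ltW.
  have -> : e * (1 + n * (t1 - t2)) =
      e + `|L| * (t1 - t2) * e + W / (e * (t1 - t2)) * (t1 - t2) * e.
    by rewrite /n; ring.
  lra.
pose Z t x := D t x * expR (- n * (t - t2)).
have jZ : jcont Z.
  apply: continuous_jcont; apply: continuous_mulf => //.
  apply: (@continuous_fst_comp R N (fun t => expR (- n * (t - t2)))) => t.
  apply: continuous_comp; last exact: continuous_expR.
  by apply: cvgM; [exact: cvg_cst | apply: cvgB; [exact: cvg_id | exact: cvg_cst]].
have [t [x [tI xr HZ]]] := jcont_attains_max x0 t01 r0 jZ.
set lam := Z t x in HZ.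
have elam : e <= lam.
  by have := HZ t2 x2 t2I x2r; rewrite {1}/Z DE// subrr mulr0 expR0 mulr1.
have lam0 : 0 < lam := lt_le_trans e0 elam.
pose q s := lam * expR (n * (s - t2)).
have Dq (s : R) : is_derive s 1 q (n * q s).
  have h1 : is_derive s 1 (fun s => n * (s - t2)) (n * 1).
    by apply: is_derive_scalef; rewrite -[1 in X in is_derive _ _ _ X]subr0; apply: is_deriveB.
  rewrite /q mulrCA; apply: is_derive_scalef.
  have := @is_derive1_comp _ expR (fun s => n * (s - t2)) s _ _ (is_derive_expR _) h1.
  by rewrite mulr1 mulrC.
have qt : w t x - u t x = q t.
  by rewrite -DE// /q /lam /Z -mulrA -expRD mulNr addNr expR0 mulr1.
have uw : u t x < w t x by rewrite -subr_gt0 qt mulr_gt0// expR_gt0.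
have tgt0 : t0 < t.
  case/andP: (tI) => + _; rewrite le_eqVlt => /orP[/eqP tE|//].
  by move: uw; rewrite -tE ltNge w0.
have tlt1 : t < t1.
  case/andP: (tI) => _; rewrite le_eqVlt => /orP[/eqP tE|//].
  have : w t x - u t x <= W by have := HW t x tI xr; rewrite DE.
  rewrite qt /q tE leNgt (lt_le_trans nW)// ler_wpM2r// expR_ge0//.
have xlt : `|x - x0| < r.
  by rewrite ltNge; apply/negP => /(wr _ _ tI); rewrite leNgt uw.
have [phi [Cphi phiE [d d0 Hd] Hphi]] : exists phi, [/\ C12 phi, phi t x = w t x,
      exists2 d, 0 < d & forall s y, `|s - t| < d -> `|y - x| < d -> phi s y <= w s y &
      dtime phi t x <=
        Pkplus k (hess phi t x) + nonlin p (u t x) + L * (w t x - u t x)].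
  by apply: wsub => //; rewrite tgt0.
have cq : continuous (fun s => n * q s).
  apply: continuous_mulf; first exact: cst_continuous.
  move=> s; apply: differentiable_continuous; apply/derivable1_diffP.
  by have [] := Dq s.
have tpos : 0 < t := le_lt_trans t00 tgt0.
have Cpsi := C12_sub_time Cphi Dq cq.
have /(usup t x _ tpos Cpsi) : loc_min_at (fun s y => u s y - (phi s y - q s)) t x.
  exists (Num.min d (Num.min (t - t0) (Num.min (t1 - t) (r - `|x - x0|)))).
    by rewrite !lt_min d0 !subr_gt0 tgt0 tlt1 xlt.
  move=> s y _; rewrite !lt_min => /and4P[sd st0 st1 _] /and4P[yd _ _ yr].
  have sI : t0 <= s <= t1 by move: st0 st1; rewrite !ltr_norml => /andP[? ?] /andP[? ?]; apply/andP; split; lra.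
  have yr' : `|y - x0| <= r.
    have := ler_distD x y x0; lra.
  have := HZ s y sI yr'; rewrite {1}/Z DE// -ler_pdivlMr ?expR_gt0//.
  rewrite -expRN mulNr opprK -/(q s) => h1.
  have h2 := Hd s y sd yd.
  rewrite phiE; move: qt; lra.
rewrite (dtime_sub_time Cphi Dq) hess_sub_time.
move: Hphi; rewrite qt => h1 h2.
have q0 : 0 < q t by rewrite mulr_gt0// expR_gt0.
have : L * q t < n * q t by rewrite ltr_pM2r.
move: h1 h2; lra.
Qed.

End Comparison.

(** * Positivity *)

Lemma jcont_comp_time (R : realType) (N : nat) (f : R -> 'rV[R]_N -> R) (g : R -> R) :
  jcont f -> continuous g -> jcont (fun t x => f (g t) x).
Proof.
move=> jf cg t x e e0; have [d d0 H] := jf (g t) x e e0.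
have /cvgrPdist_lt/(_ _ d0)/nbhs_ballP[d' /= d'0 H'] := cg t.
exists (Num.min d d'); first by rewrite lt_min d0.
move=> s y; rewrite !lt_min => /andP[_ st] /andP[yx _]; apply: H => //.
by rewrite distrC; apply: H'; rewrite -ball_normE /= distrC.
Qed.

Section Solution.
Variables (R : realType) (N k : nat) (p : R).
Hypothesis (k1 : (1 <= k)%N) (kN : (k <= N)%N).
Variable u : R -> 'rV[R]_N -> R.
Hypothesis uvisc : visc_sol k p u.
Hypothesis ustrip : forall T, 0 < T -> unif_cont_strip u T.
Implicit Types (x y : 'rV[R]_N) (t s : R).

Lemma jcont_clamp_strip (t0 t1 : R) : 0 <= t0 -> t0 <= t1 ->
  jcont (fun t x => u (clamp t0 t1 t) x).
Proof.
move=> t00 t01 t x e e0.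
have [] := @ustrip (t1 + 1) _ e e0; first by rewrite ltr_wpDl// (le_trans t00).
move=> d d0 H; exists d => // s y st yx.
have /andP[cs0 cs1] := clamp_itv s t01; have /andP[ct0 ct1] := clamp_itv t t01.
apply: H => //; rewrite ?(le_trans t00) ?(le_trans _ (ltW (ltrDl _ _)))//.
- by rewrite (le_trans cs1)// lerDl.
- by rewrite (le_trans ct1)// lerDl.
- exact: le_lt_trans (clamp_lipschitz s t t01) st.
Qed.

(** The modulus of continuity in time is uniform in [x], so each time step of length [d / 2] costs
    at most 1, and finitely many steps cover [[0, T]]. *)
Lemma strip_bounded_below (T : R) : 0 < T -> (forall x, 0 <= u 0 x) ->
  exists M, forall t x, 0 <= t <= T -> - M <= u t x.
Proof.
move=> T0 u0; have [//|d d0 H] := @ustrip T _ 1 ltr01.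
have step (n : nat) t x : 0 <= t <= T -> t <= n%:R * (d / 2) -> - n%:R <= u t x.
  elim: n t => [|n IH] t /andP[t0 tT] tn.
    have -> : t = 0 by apply/eqP; rewrite eq_le t0 andbT (le_trans tn)// mul0r.
    by rewrite oppr0.
  have [td|td] := leP t (d / 2).
    have := H t 0 x x t0 tT (lexx _) (ltW T0).
    rewrite subr0 subrr normr0 ger0_norm// => /(_ _ d0).
    have -> : t < d by lra.
    move=> /(_ isT); rewrite ltr_norml => /andP[h _].
    by have := u0 x; have : 0 <= n%:R :> R by []; rewrite -natr1; lra.
  have tI : 0 <= t - d / 2 <= T by apply/andP; split; lra.
  have := IH (t - d / 2) tI; rewrite -natr1 mulrDl mul1r in tn.
  have -> : t - d / 2 <= n%:R * (d / 2) by lra.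
  move=> /(_ isT) h.
  have /andP[tI1 tI2] := tI.
  have := H t (t - d / 2) x x t0 tT tI1 tI2.
  rewrite subrr normr0 => /(_ _ d0); rewrite opprB addrC subrK ger0_norm; last by lra.
  have -> : d / 2 < d by lra.
  move=> /(_ isT); rewrite ltr_norml => /andP[h2 _].
  by rewrite -natr1; lra.
exists (Num.truncn (T / (d / 2))).+1%:R => t x tI; apply: step => //.
have /andP[_ tT] := tI; rewrite (le_trans tT)// -ler_pdivrMr; last by lra.
by rewrite ltW// truncnS_gt.
Qed.

Lemma nonlin_ge0 (v : R) : 0 <= nonlin p v.
Proof. exact: powR_ge0. Qed.

Lemma is_derive_affine (a b t : R) : is_derive t 1 (fun s => a + b * s) b.
Proof.
apply: is_derive_addcf; rewrite -[X in is_derive _ _ _ X]mulr1.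
exact: is_derive_scalef.
Qed.

(** The barrier [- e (2 k t + |x - x0|^2)] solves the equation without reaction and drops below the
    uniform lower bound of [u] far away. Comparison at [x0] and small [e] give the claim. *)
Lemma supersolution_ge0 : (forall x, 0 <= u 0 x) -> forall t x, 0 <= t -> 0 <= u t x.
Proof.
move=> u0 t2 x0 t20.
have T0 : 0 < t2 + 1 by rewrite ltr_wpDl.
have [M HM] := strip_bounded_below T0 u0.
suff H e : 0 < e -> - e * (2 * k%:R * t2) <= u t2 x0.
  rewrite leNgt; apply/negP => un.
  have c0 : 0 < 2 * k%:R * t2 + 1 by rewrite ltr_wpDl// !mulr_ge0.
  have := H (- u t2 x0 / (2 * (2 * k%:R * t2 + 1))).
  have -> : 0 < - u t2 x0 / (2 * (2 * k%:R * t2 + 1)).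
    by rewrite divr_gt0 ?mulr_gt0 ?oppr_gt0.
  move=> /(_ isT); set c := 2 * k%:R * t2 in c0 *.
  have -> : - (- u t2 x0 / (2 * (c + 1))) * c = u t2 x0 * (c / (2 * (c + 1))).
    by field; rewrite gt_eqF.
  have h : c / (2 * (c + 1)) < 1.
    by rewrite ltr_pdivrMr; [lra|rewrite mulr_gt0].
  rewrite leNgt -subr_gt0 => /negP; apply.
  have -> : u t2 x0 * (c / (2 * (c + 1))) - u t2 x0 = (- u t2 x0) * (1 - c / (2 * (c + 1))).
    by ring.
  by rewrite mulr_gt0 ?oppr_gt0 ?subr_gt0.
move=> e0.
pose a t := -1 + (- (2 * k%:R * e)) * t.
pose w := profile x0 a (fun=> 1) (fun=> e) 1.
have wE t x : w t x = - e * (2 * k%:R * t) - e * sqdist x0 x.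
  by rewrite /w /profile /a; ring.
have Da (t : R) : is_derive t 1 a (- (2 * k%:R * e)) by exact: is_derive_affine.
have D1 (t : R) : is_derive t 1 (fun _ : R => 1 : R) 0 by exact: is_derive_cst.
have De (t : R) : is_derive t 1 (fun _ : R => e) 0 by exact: is_derive_cst.
have cc (c : R) : continuous (fun _ : R => c) by exact: cst_continuous.
have Cw : C12 w by exact: (C12_profile x0 1 Da D1 De (cc _) (cc _) (cc _)).
have jw : jcont w by have [_ _ _ []] := Cw.
(* The summand 1 ensures [r <= r ^+ 2], so a bound linear in [r] passes to the squared distance. *)
pose r := 1 + `|M| / e.
have sq_le : forall x, r <= `|x - x0| -> M <= e * sqdist x0 x.
  move=> x rx; have r1 : 1 <= r by rewrite lerDl divr_ge0// ltW.
  rewrite (le_trans (ler_norm M))// mulrC -ler_pdivrMr//.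
  rewrite (le_trans _ (normsq_le_sqdist x0 x))//.
  apply: (@le_trans _ _ r); first by rewrite lerDr.
  apply: (le_trans rx); rewrite expr2 ler_peMl// (le_trans r1)//.
have [] : w t2 x0 <= u t2 x0 /\ True; last first.
  by rewrite wE /sqdist big1 ?mulr0 ?subr0// => j _; rewrite subrr mxE expr0n.
split => //.
apply: (@comparison _ _ k p 0 (t2 + 1) 0 r x0 u w uvisc (lexx _)).
- by apply: jcont_clamp_strip => //; exact: ltW.
- exact: jcont_comp_time jw (continuous_clamp (ltW T0)).
- move=> x; rewrite wE mulr0 mulr0 add0r (le_trans _ (u0 x))// oppr_le0.
  by rewrite mulr_ge0 ?sqdist_ge0// ltW.
- move=> t x tI rx; apply: le_trans (HM t x tI).
  rewrite wE; have := sq_le x rx; have /andP[t0 _] := tI.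
  have : 0 <= e * (2 * k%:R * t) by rewrite !mulr_ge0// ltW.
  by rewrite mulNr; lra.
- move=> t x tI _; exists w; split => //; first by exists 1.
  rewrite (dtime_profile x0 1 Da D1 De) Pkplus_hess_profile//; last first.
    by rewrite muln0 mulr0 mul0r.
  rewrite muln0; have := nonlin_ge0 (u t x); rewrite expr0; lra.
- by rewrite t20 ltrDl ltr01.
Qed.

End Solution.

(** * Blow-up from large data *)

Section RealInequalities.
Variable R : realType.
Implicit Types (x v w p : R).

Lemma bernoulli_1B x (n : nat) : 0 <= x <= 1 -> 1 - n%:R * (1 - x) <= x ^+ n.
Proof.
move=> /andP[x0 x1]; elim: n => [|n IH]; first by rewrite expr0; lra.
rewrite exprS -natr1.
have h1 : x * (1 - n%:R * (1 - x)) <= x * x ^+ n by rewrite ler_wpM2l.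
have h2 : 0 <= n%:R * (1 - x) ^+ 2 by rewrite mulr_ge0// sqr_ge0.
apply: le_trans h1; lra.
Qed.

(** By homogeneity only the ratio [v / w] in [[0, 1]] matters, and there Bernoulli with the integer
    exponent [n >= 1 + p] replaces the mean value theorem. *)
Lemma powR_lipschitz p (n : nat) v w W : 0 < p -> 1 + p <= n%:R ->
  0 <= v -> v <= w -> w <= W ->
  w `^ (1 + p) - v `^ (1 + p) <= n%:R * W `^ p * (w - v).
Proof.
move=> p0 pn v0 vw wW.
have p10 : 1 + p != 0 by rewrite gt_eqF// addr_gt0.
have [w0|w0] := leP w 0.
  have -> : w = 0 by apply/eqP; rewrite eq_le w0 (le_trans v0).
  have -> : v = 0 by apply/eqP; rewrite eq_le v0 andbT (le_trans vw).
  by rewrite !subrr mulr0.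
pose x := v / w.
have vE : v = w * x by rewrite /x mulrC divfK// gt_eqF.
have x0 : 0 <= x by rewrite divr_ge0// ltW.
have x1 : x <= 1 by rewrite ler_pdivrMr// mul1r.
have h : 1 - x `^ (1 + p) <= n%:R * (1 - x).
  have [->|xn0] := eqVneq x 0.
    by rewrite powR0// !subr0 mulr1 (le_trans _ pn)// lerDl ltW.
  have xpos : 0 < x by rewrite lt_neqAle eq_sym xn0.
  have := bernoulli_1B n (introT andP (conj x0 x1)).
  have : x ^+ n <= x `^ (1 + p) by rewrite -powR_mulrn// ger_powR// xpos.
  lra.
have wE : w `^ (1 + p) = w * w `^ p.
  by rewrite powRD ?powRr1 ?(ltW w0)// (gt_eqF w0) implybT.
rewrite vE powRM ?(ltW w0)//.
have -> : w `^ (1 + p) - w `^ (1 + p) * x `^ (1 + p) = w * w `^ p * (1 - x `^ (1 + p)).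
  by rewrite wE; ring.
have -> : n%:R * W `^ p * (w - w * x) = w * W `^ p * (n%:R * (1 - x)) by ring.
apply: (@le_trans _ _ (w * w `^ p * (n%:R * (1 - x)))).
  by rewrite ler_wpM2l// mulr_ge0 ?powR_ge0// ltW.
rewrite ler_wpM2r ?mulr_ge0 ?subr_ge0// ler_wpM2l ?(ltW w0)//.
by rewrite ge0_ler_powR ?nnegrE ?(ltW p0) ?(ltW w0) ?(le_trans (ltW w0))//.
Qed.

(* [g * rho ^+ n] is the height of the shrinking paraboloid, [rho] being the ratio of the initial to the current remaining lifetime. *)
Lemma paraboloid_reaction p (n : nat) (tau g rho w : R) :
  0 < p -> 1 <= n%:R * p -> 0 < tau -> 0 < g -> 1 <= rho -> 0 < w ->
  n.+1%:R * (2 * n.+1%:R) `^ p <= g `^ p * tau ->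
  rho / tau * (n.+1%:R * w - g * rho ^+ n / 2) <= w `^ (1 + p).
Proof.
move=> p0 np tau0 g0 rho1 w0 big.
set G := g * rho ^+ n.
have rho0 : 0 < rho by exact: lt_le_trans rho1.
have G0 : 0 < G by rewrite mulr_gt0// exprn_gt0.
have n0 : 0 < 2 * n.+1%:R :> R by rewrite mulr_gt0.
(* Near the edge of the paraboloid the left-hand side is nonpositive. Otherwise [w] is comparable to
   [G], and since [n p >= 1] the factor [G ^ p] grows at least like [rho], so the reaction wins. *)
have [wG|wG] := leP (n.+1%:R * w) (G / 2).
  by rewrite (le_trans _ (powR_ge0 _ _))// mulr_ge0_le0 ?subr_le0// divr_ge0// ltW.
rewrite powRD ?powRr1 ?(ltW w0)//; last by rewrite (gt_eqF w0) implybT.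
apply: (@le_trans _ _ (w * (rho / tau * n.+1%:R))).
  have -> : w * (rho / tau * n.+1%:R) = rho / tau * (n.+1%:R * w) by ring.
  rewrite ler_wpM2l ?divr_ge0 ?(ltW rho0) ?(ltW tau0)//.
  by rewrite gerBl divr_ge0// ltW.
rewrite ler_pM2l//.
have h1 : (G / (2 * n.+1%:R)) `^ p <= w `^ p.
  rewrite ge0_ler_powR ?nnegrE ?(ltW p0) ?(ltW w0) ?divr_ge0 ?(ltW G0) ?(ltW n0)//.
  rewrite ler_pdivrMr//; move: wG; rewrite ltr_pdivrMr//; lra.
apply: le_trans h1.
have -> : (G / (2 * n.+1%:R)) `^ p = G `^ p / (2 * n.+1%:R) `^ p.
  rewrite powRM ?invr_ge0 ?(ltW G0) ?(ltW n0)//; congr (_ * _).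
  by rewrite -[in LHS]powR_inv1 ?(ltW n0)// -powRrM mulN1r powRN.
rewrite ler_pdivlMr ?powR_gt0//.
have h2 : g `^ p * rho <= G `^ p.
  rewrite powRM ?(ltW g0) ?exprn_ge0 ?(ltW rho0)// ler_wpM2l ?powR_ge0//.
  by rewrite -powR_mulrn ?(ltW rho0)// -powRrM -[leLHS]powRr1 ?(ltW rho0)// ler_powR.
apply: le_trans h2.
have -> : rho / tau * n.+1%:R * (2 * n.+1%:R) `^ p =
    rho / tau * (n.+1%:R * (2 * n.+1%:R) `^ p) by ring.
have -> : g `^ p * rho = rho / tau * (g `^ p * tau) by field; rewrite gt_eqF.
by rewrite ler_wpM2l// divr_ge0// ltW.
Qed.

(** Both bounds agree with [1 / (1 - s)] to first order at 0, so substituting them preserves the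
    time derivative at contact; they are [quad] with [kap = 0] and [kap = 2]. *)
Lemma inv1B_bounds (s : R) : `|s| <= 1 / 2 ->
  [/\ 0 <= 1 + s, 1 + s <= (1 - s)^-1 & (1 - s)^-1 <= 1 + s + 2 * s ^+ 2].
Proof.
rewrite ler_norml => /andP[s1 s2].
have s0 : 0 < 1 - s by lra.
split; first lra.
  by rewrite -[leRHS]mul1r ler_pdivlMr//; have := sqr_ge0 s; lra.
rewrite -[leLHS]mul1r ler_pdivrMr//.
have -> : (1 + s + 2 * s ^+ 2) * (1 - s) = 1 + s ^+ 2 * (1 - 2 * s) by ring.
by rewrite lerDl mulr_ge0 ?sqr_ge0//; lra.
Qed.

Lemma inv1D_bounds (s : R) : `|s| <= 1 / 2 ->
  0 < 1 + s /\ (1 + s)^-1 <= 1 - s + 2 * s ^+ 2.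
Proof.
move=> hs; have [] := @inv1B_bounds (- s); first by rewrite normrN.
by rewrite opprK sqrrN => _ _ h; move: hs; rewrite ler_norml => /andP[? ?]; split => //; lra.
Qed.

End RealInequalities.

Lemma continuous_invf (R : realType) (T : topologicalType) (f : T -> R) :
  continuous f -> (forall z, f z != 0) -> continuous (fun z => (f z)^-1).
Proof. by move=> cf f0 z; apply: cvgV; [exact: f0 | exact: cf]. Qed.

(* A test function must be C12 at every real time, so near the contact time [t] singular factors such as [1 / (T - t)] are replaced by powers of the quadratic polynomial [quad]. *)
Section Quad.
Variables (R : realType) (e kap t C : R) (n : nat).

Definition quad (s : R) : R := 1 + e * (s - t) + kap * (e * (s - t)) ^+ 2.
Definition quad' (s : R) : R := e + 2 * kap * e ^+ 2 * (s - t).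

Lemma quad_center : quad t = 1.
Proof. by rewrite /quad subrr; ring. Qed.

Lemma quad'_center : quad' t = e.
Proof. by rewrite /quad' subrr; ring. Qed.

Lemma is_derive_quad (s : R) : is_derive s 1 quad (quad' s).
Proof.
have lin : is_derive s 1 (fun s => e * (s - t)) e.
  rewrite (_ : (fun s => _) = fun s => - (e * t) + e * s); last first.
    by apply/funext => r; ring.
  exact: is_derive_affine.
rewrite (_ : quad' s = e + kap * (2%:R * (e * (s - t)) ^+ 1 * e)); last first.
  by rewrite /quad'; ring.
apply: is_derive_addf; first exact: is_derive_addcf.
by apply: is_derive_scalef; exact: (is_derive_expf 2 lin).
Qed.

Lemma is_derive_quadX (s : R) :
  is_derive s 1 (fun s => C * quad s ^+ n) (C * (n%:R * quad s ^+ n.-1 * quad' s)).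
Proof. by apply: is_derive_scalef; apply: is_derive_expf; exact: is_derive_quad. Qed.

Lemma continuous_derive_quadX :
  continuous (fun s : R => C * (n%:R * quad s ^+ n.-1 * quad' s)).
Proof.
have cst (r : R) : continuous (fun _ : R => r) by exact: cst_continuous.
have ci : continuous (fun s : R => s - t).
  by move=> s; apply: cvgB; [exact: cvg_id | exact: cvg_cst].
have cl : continuous (fun s : R => e * (s - t)) by apply: continuous_mulf.
have cq : continuous quad.
  apply: continuous_addf; first by apply: continuous_addf.
  by apply: continuous_mulf => //; exact: continuous_expf.
apply: continuous_mulf => //; apply: continuous_mulf.
  by apply: continuous_mulf => //; exact: continuous_expf.
by apply: continuous_addf => //; exact: continuous_mulf.
Qed.

End Quad.

Section Blowup.
Variables (R : realType) (N k : nat) (p : R).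
Hypothesis (k1 : (1 <= k)%N) (kN : (k <= N)%N) (p0 : 0 < p).
Variable u : R -> 'rV[R]_N -> R.
Hypothesis uvisc : visc_sol k p u.
Hypothesis ustrip : forall T, 0 < T -> unif_cont_strip u T.
Hypothesis u_ge0 : forall t x, 0 <= t -> 0 <= u t x.
Implicit Types (x y : 'rV[R]_N).

Section Paraboloid.
Variables (n : nat) (t0 tau g : R) (x0 : 'rV[R]_N).
Hypotheses (np : 1 <= n%:R * p) (t00 : 0 <= t0) (tau0 : 0 < tau) (g0 : 0 < g).
Hypothesis big : n.+1%:R * (2 * n.+1%:R) `^ p <= g `^ p * tau.
Hypothesis u_init : forall x, sqdist x0 x <= 4 * k%:R * tau -> g <= u t0 x.

Let rho (t : R) : R := tau / (t0 + tau - t).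
(** With this value the paraboloid is positive exactly for [|x - x0|^2 < 4 k (t0 + tau - t)], and
    diffusion costs half of [g rho^n / (t0 + tau - t)], the term [- g rho^n / 2] of
    [paraboloid_reaction]. *)
Let B : R := g / (4 * k%:R * tau).
Let w (t : R) x := g * rho t ^+ n - B * rho t ^+ n.+1 * sqdist x0 x.

Let k0 : 0 < k%:R :> R. Proof. by rewrite ltr0n. Qed.
Let n0 : (0 < n)%N.
Proof. by rewrite lt0n; apply/eqP => nE; move: np; rewrite nE mul0r; lra. Qed.

Let B0 : 0 < B. Proof. by rewrite divr_gt0// !mulr_gt0. Qed.

Let rho_ge1 t : t0 <= t < t0 + tau -> 1 <= rho t.
Proof. by move=> /andP[h1 h2]; rewrite ler_pdivlMr; lra. Qed.

Let w_le0 t x : t0 <= t < t0 + tau -> 4 * k%:R * tau <= sqdist x0 x -> w t x <= 0.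
Proof.
move=> tI sq; have r1 := rho_ge1 tI.
have r0 : 0 < rho t by exact: lt_le_trans r1.
have -> : w t x = B * rho t ^+ n * (4 * k%:R * tau - rho t * sqdist x0 x).
  by rewrite /w exprS /B; field; rewrite !gt_eqF.
apply: mulr_ge0_le0; first by rewrite mulr_ge0 ?exprn_ge0 ?(ltW B0) ?(ltW r0).
rewrite subr_le0; by rewrite (le_trans sq)// ler_peMl// sqdist_ge0.
Qed.

Let w_test t x : t0 < t < t0 + tau -> 0 < w t x ->
  exists phi, [/\ C12 phi, phi t x = w t x,
      exists2 d, 0 < d & forall s y, `|s - t| < d -> `|y - x| < d -> phi s y <= w s y &
      dtime phi t x <= Pkplus k (hess phi t x) + nonlin p (w t x)].
Proof.
move=> /andP[t0t tT] wpos.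
pose T := t0 + tau - t; have T0 : 0 < T by rewrite /T; lra.
have r1 : 1 <= rho t by apply: rho_ge1; rewrite tT ltW.
have r0 : 0 < rho t by exact: lt_le_trans r1.
pose A := g * rho t ^+ n; pose C := B * rho t ^+ n.+1.
have A0 : 0 < A by rewrite mulr_gt0 ?exprn_gt0.
have C0 : 0 < C by rewrite mulr_gt0 ?exprn_gt0.
(* The test function must lie below [w]: the added power is bounded from below ([kap = 0]), the
   subtracted one from above ([kap = 2]). *)
pose a s := -1 + A * quad T^-1 0 t s ^+ n.
pose c s := C * quad T^-1 2 t s ^+ n.+1.
have Da (s : R) : is_derive s 1 a
    (A * (n%:R * quad T^-1 0 t s ^+ n.-1 * quad' T^-1 0 t s)).
  by apply: is_derive_addcf; exact: is_derive_quadX.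
have D1 (s : R) : is_derive s 1 (fun _ : R => 1 : R) 0 by exact: is_derive_cst.
have Dc (s : R) : is_derive s 1 c
    (C * (n.+1%:R * quad T^-1 2 t s ^+ n * quad' T^-1 2 t s)).
  exact: is_derive_quadX.
exists (profile x0 a (fun=> 1) c 1); split.
- apply: (C12_profile x0 1 Da D1 Dc); try exact: continuous_derive_quadX.
  exact: cst_continuous.
- by rewrite /profile /a /c !quad_center !expr1n /w /A /C; ring.
- exists (T / 2); first by rewrite divr_gt0.
  move=> s y st _.
  pose sg := T^-1 * (s - t).
  have hsg : `|sg| <= 1 / 2.
    rewrite /sg normrM normfV (gtr0_norm T0) mulrC ler_pdivrMr// ltW//.
    by rewrite mulrC mulrA mulr1.
  have [h0 h1 h2] := inv1B_bounds hsg.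
  have sg1 : 0 < 1 - sg by move: hsg; rewrite ler_norml => /andP[? ?]; lra.
  have rhoE : rho s = rho t * (1 - sg)^-1.
    have -> : rho s = tau / (T * (1 - sg)).
      congr (_ / _); rewrite mulrBr mulr1 /sg mulrA divff ?gt_eqF// mul1r /T; ring.
    by rewrite invfM mulrA.
  rewrite /profile /a /c /w !expr1 mul1r.
  have -> : quad T^-1 0 t s = 1 + sg by rewrite /quad -/sg; ring.
  have -> : quad T^-1 2 t s = 1 + sg + 2 * sg ^+ 2 by rewrite /quad -/sg; ring.
  rewrite rhoE.
  have -> : g * (rho t * (1 - sg)^-1) ^+ n = A * (1 - sg)^-1 ^+ n.
    by rewrite exprMn mulrA.
  have -> : B * (rho t * (1 - sg)^-1) ^+ n.+1 = C * (1 - sg)^-1 ^+ n.+1.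
    by rewrite exprMn mulrA.
  have e1 : (1 + sg) ^+ n <= (1 - sg)^-1 ^+ n.
    by rewrite lerXn2r// nnegrE// invr_ge0 ltW.
  have e2 : (1 - sg)^-1 ^+ n.+1 <= (1 + sg + 2 * sg ^+ 2) ^+ n.+1.
    by rewrite lerXn2r ?nnegrE// ?invr_ge0 ?(ltW sg1)// addr_ge0// mulr_ge0 ?sqr_ge0.
  have f1 : A * (1 + sg) ^+ n <= A * (1 - sg)^-1 ^+ n.
    by rewrite ler_wpM2l// ltW.
  have f2 : C * sqdist x0 y * (1 - sg)^-1 ^+ n.+1 <=
            C * sqdist x0 y * (1 + sg + 2 * sg ^+ 2) ^+ n.+1.
    by rewrite ler_wpM2l// mulr_ge0 ?sqdist_ge0// ltW.
  move: f1 f2; lra.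
rewrite (dtime_profile x0 1 Da D1 Dc) Pkplus_hess_profile//; last first.
  by rewrite muln0 mulr0 mul0r.
rewrite /c !quad_center !quad'_center !expr1n !expr0 muln0 /nonlin max_l ?(ltW wpos)//.
have := paraboloid_reaction p0 np tau0 g0 r1 wpos big.
have -> : rho t / tau = T^-1.
  by rewrite /rho -/T; field; rewrite !gt_eqF.
have CE : 4 * k%:R * C = A * T^-1.
  have rE : rho t = tau / T by [].
  rewrite /C /A /B exprS {1}rE; move: (rho t ^+ n) => X.
  by field; rewrite !gt_eqF.
have -> : T^-1 * (n.+1%:R * w t x - g * rho t ^+ n / 2) =
    n%:R * A * T^-1 - n.+1%:R * C * T^-1 * sqdist x0 x + A * T^-1 / 2.
  by rewrite /w -/A -/C -natr1; field; rewrite gt_eqF.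
rewrite -CE; lra.
Qed.

Let w_le_u t x : t0 <= t < t0 + tau -> w t x <= u t x.
Proof.
move=> /andP[t0t tT].
(* Stopping strictly before the singular time keeps [rho], hence [w] and the Lipschitz constant of
   the reaction, bounded. *)
pose t1 := (t + (t0 + tau)) / 2.
have t01 : t0 <= t1 by rewrite /t1; lra.
have t1T : t1 < t0 + tau by rewrite /t1; lra.
have [m pm] : exists m : nat, 1 + p <= m%:R.
  by exists (Num.truncn (1 + p)).+1; rewrite ltW// truncnS_gt.
have rho1 : 0 < rho t1 by rewrite divr_gt0//; lra.
have wW s y : t0 <= s <= t1 -> w s y <= g * rho t1 ^+ n.
  move=> /andP[s0 s1]; have h1 : 1 <= rho s by apply: rho_ge1; rewrite s0 (le_lt_trans s1).
  rewrite /w; apply: (@le_trans _ _ (g * rho s ^+ n)).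
    rewrite gerBl; apply: mulr_ge0 (sqdist_ge0 _ _); apply: mulr_ge0 (ltW B0) _.
    by rewrite exprn_ge0// (le_trans _ h1).
  rewrite ler_wpM2l ?(ltW g0)// lerXn2r ?nnegrE ?(ltW rho1) ?(le_trans _ h1)//.
  by rewrite /rho ler_wpM2l ?(ltW tau0)// lef_pV2 ?posrE; lra.
apply: (@comparison _ _ k p t0 t1 (m%:R * (g * rho t1 ^+ n) `^ p) (1 + 4 * k%:R * tau) x0 u w uvisc t00).
- exact: jcont_clamp_strip.
- apply: continuous_jcont.
  have cr : continuous (fun z : R * 'rV[R]_N => rho (clamp t0 t1 z.1)).
    apply: (@continuous_fst_comp R N (fun s => rho (clamp t0 t1 s))).
    apply: continuous_mulf; first exact: cst_continuous.
    apply: continuous_invf.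
      apply: continuous_addf; first exact: cst_continuous.
      by apply: continuous_oppf; exact: continuous_clamp.
    move=> s; have /andP[_ h] := clamp_itv s t01.
    by rewrite gt_eqF// subr_gt0 (le_lt_trans h).
  rewrite /w; apply: continuous_addf.
    by apply: continuous_mulf; [exact: cst_continuous | exact: continuous_expf].
  apply: continuous_oppf; apply: continuous_mulf.
    by apply: continuous_mulf; [exact: cst_continuous | exact: continuous_expf].
  exact: (continuous_snd_comp (@continuous_sqdist _ _ x0)).
- move=> y; have [sq|/ltW sq] := leP (sqdist x0 y) (4 * k%:R * tau).
    apply: le_trans (u_init sq); rewrite /w.
    have -> : rho t0 = 1 by rewrite /rho addrC addKr divff// gt_eqF.
    by rewrite !expr1n !mulr1 gerBl mulr_ge0 ?sqdist_ge0// ltW.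
  by apply: le_trans (u_ge0 y t00); apply: w_le0 => //; rewrite lexx ltrDl.
- move=> s y /andP[s0 s1] ry; apply: le_trans (u_ge0 y (le_trans t00 s0)).
  apply: w_le0; first by rewrite s0 (le_lt_trans s1).
  apply: le_trans (normsq_le_sqdist x0 y).
  have c0 : 0 < 4 * k%:R * tau by rewrite !mulr_gt0.
  have y1 : 1 <= `|y - x0| by apply: le_trans ry; lra.
  have : `|y - x0| <= `|y - x0| ^+ 2 by rewrite expr2 ler_peMl.
  lra.
- move=> s y /andP[s0 s1] uw; have us : 0 <= u s y by apply: u_ge0; rewrite (le_trans t00)// ltW.
  have wpos : 0 < w s y := le_lt_trans us uw.
  have sI : t0 < s < t0 + tau by rewrite s0 (lt_trans s1).
  have [phi [h1 h2 h3 h4]] := w_test sI wpos.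
  exists phi; split => //; apply: le_trans h4 _; rewrite -addrA lerD2l.
  rewrite /nonlin !max_l ?(ltW wpos)// -lerBlDl.
  by apply: powR_lipschitz => //; [exact: ltW | apply: wW; rewrite !ltW].
- by rewrite t0t /t1; lra.
Qed.

(** Uniform continuity up to the singular time [T] bounds [u (T - e) x0] by [M], while the
    paraboloid below it has height [g (tau / e)^n >= 2 M] at its centre. *)
Lemma large_data_blowup : False.
Proof.
pose T := t0 + tau; have T0 : 0 < T by rewrite ltr_wpDl.
have [d d0 H] := @ustrip T T0 1 ltr01.
pose M := u T x0 + 1; have M1 : 1 <= M by rewrite lerDr u_ge0// ltW.
pose e := Num.min (d / 2) (Num.min tau (g * tau / (2 * M))).
have M0 : 0 < M by exact: lt_le_trans M1.
have e0 : 0 < e by rewrite !lt_min tau0 /= !divr_gt0// mulr_gt0.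
have ed : e <= d / 2 by rewrite /e ge_min lexx.
have etau : e <= tau by rewrite /e !ge_min lexx orbT.
have eM : e <= g * tau / (2 * M) by rewrite /e !ge_min lexx !orbT.
have tI : t0 <= T - e < t0 + tau by rewrite /T; apply/andP; split; lra.
have := w_le_u x0 tI.
have -> : w (T - e) x0 = g * rho (T - e) ^+ n.
  by rewrite /w /sqdist big1 ?mulr0 ?subr0// => j _; rewrite subrr mxE expr0n.
have rE : rho (T - e) = tau / e by rewrite /rho /T opprB addrC subrK.
have r1 := rho_ge1 tI.
have : 2 * M <= g * rho (T - e) ^+ n.
  apply: (@le_trans _ _ (g * rho (T - e))).
    by rewrite rE mulrA ler_pdivlMr// mulrC -ler_pdivlMr// mulr_gt0.
  by rewrite ler_wpM2l ?(ltW g0)// -[leLHS]expr1 ler_weXn2l.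
have /andP[tI0 tI1] := tI.
have := H (T - e) T x0 x0 (le_trans t00 tI0) (ltW tI1) (ltW T0) (lexx _).
rewrite subrr normr0 => /(_ _ d0).
rewrite -addrAC subrr add0r normrN gtr0_norm//.
have -> : e < d by lra.
move=> /(_ isT); rewrite ltr_norml => /andP[_].
rewrite /M; move: M1; rewrite /M; lra.
Qed.

End Paraboloid.
End Blowup.

(** * Spreading *)

Section PowR.
Variable R : realType.

Lemma continuous_powRf (T : topologicalType) (f : T -> R) (a : R) :
  continuous f -> (forall z, 0 < f z) -> continuous (fun z => f z `^ a).
Proof.
move=> cf f0.
rewrite (_ : (fun z => _) = fun z => expR (a * ln (f z))); last first.
  by apply/funext => z; rewrite /powR gt_eqF.
move=> z; apply: continuous_comp; last exact: continuous_expR.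
apply: cvgM; first exact: cvg_cst.
by apply: continuous_comp; [exact: cf | exact: continuous_ln].
Qed.

(** The tangent at [s = 0] replaces the decay factor [T^-al] in a test function, as [quad] with
    [kap = 0]. *)
Lemma powRN_ge1B (a s : R) : 0 <= a -> -1 < s -> 1 - a * s <= (1 + s) `^ (- a).
Proof.
move=> a0 s1; rewrite /powR gt_eqF; last by lra.
apply: le_trans (expR_ge1Dx _); rewrite lerD2l mulNr lerN2.
by rewrite ler_wpM2l// le_ln1Dx.
Qed.

End PowR.

Section Spreading.
Variables (R : realType) (N k : nat) (p : R).
Hypothesis (k1 : (1 <= k)%N) (kN : (k <= N)%N).
Variable u : R -> 'rV[R]_N -> R.
Hypothesis uvisc : visc_sol k p u.
Hypothesis ustrip : forall T, 0 < T -> unif_cont_strip u T.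
Hypothesis u_ge0 : forall t x, 0 <= t -> 0 <= u t x.
Implicit Types (x y : 'rV[R]_N).
Variables (m : nat) (al nu th h : R) (x0 : 'rV[R]_N).
Hypotheses (m_odd : odd m) (m2 : (2 <= m)%N).
Hypotheses (al0 : 0 <= al) (nu0 : 0 < nu) (th0 : 0 < th) (h0 : 0 < h).
Hypothesis al_lb : 2 * k%:R * (m%:R * nu) <= al.
Hypothesis m_lb : m%:R + al <= 4 * nu * (m * m.-1)%:R.
Hypothesis u_init : forall x, sqdist x0 x < th / nu -> h <= u 0 x.

Let F (t : R) : R := h * ((th + t) / th) `^ (- al).
(* [m] is odd, so [w] is nonpositive outside the ball [nu |x - x0|^2 < th + t]. *)
Let w (t : R) x := F t * (1 - nu / (th + t) * sqdist x0 x) ^+ m.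

Let m0 : (0 < m)%N. Proof. exact: ltnW. Qed.

Let F0 (t : R) : 0 <= t -> 0 < F t.
Proof. by move=> t0; rewrite mulr_gt0// powR_gt0// divr_gt0// ltr_pwDl. Qed.

Let w_le0 (t : R) x : 0 <= t -> (th + t) / nu <= sqdist x0 x -> w t x <= 0.
Proof.
move=> t0 sq; have T0 : 0 < th + t by rewrite ltr_pwDl.
apply: mulr_ge0_le0; first exact: ltW (F0 t0).
rewrite exprn_odd_le0// subr_le0; move: sq; rewrite ler_pdivrMr// => sq.
by rewrite mulrAC ler_pdivlMr// mul1r mulrC.
Qed.

Let w_test (t : R) x : 0 < t -> 0 < w t x ->
  exists phi, [/\ C12 phi, phi t x = w t x,
      exists2 d, 0 < d & forall s y, `|s - t| < d -> `|y - x| < d -> phi s y <= w s y &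
      dtime phi t x <= Pkplus k (hess phi t x)].
Proof.
move=> t0 wpos; pose T := th + t; have T0 : 0 < T by rewrite ltr_pwDl// ltW.
have Ft0 := F0 (ltW t0).
pose a (s : R) : R := 0.
pose b s := F t * quad (- al / T) 0 t s ^+ 1.
pose c s := nu / T * quad (- T^-1) 2 t s ^+ 1.
have cst0 (r : R) : continuous (fun _ : R => r) by exact: cst_continuous.
have Da (s : R) : is_derive s 1 a 0 by exact: is_derive_cst.
have D1 (s : R) : is_derive s 1 (fun _ : R => 1 : R) 0 by exact: is_derive_cst.
have Db (s : R) : is_derive s 1 b
    (F t * (1%:R * quad (- al / T) 0 t s ^+ 0 * quad' (- al / T) 0 t s)).
  exact: is_derive_quadX.
have Dc (s : R) : is_derive s 1 c
    (nu / T * (1%:R * quad (- T^-1) 2 t s ^+ 0 * quad' (- T^-1) 2 t s)).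
  exact: is_derive_quadX.
have ccd : continuous (fun s : R =>
    nu / T * (1%:R * quad (- T^-1) 2 t s ^+ 0 * quad' (- T^-1) 2 t s)).
  exact: (continuous_derive_quadX (n := 1)).
have cb : b t = F t by rewrite /b quad_center expr1n mulr1.
have cc : c t = nu / T by rewrite /c quad_center expr1n mulr1.
set Y := 1 - nu / T * sqdist x0 x.
have Y0 : 0 < Y by move: wpos; rewrite pmulr_rgt0// exprn_odd_gt0.
have Y1 : Y <= 1 by rewrite gerBl mulr_ge0 ?sqdist_ge0// divr_ge0// ltW.
exists (profile x0 a b c m); split.
- apply: (C12_profile x0 m Da Db Dc) => //.
  exact: (continuous_derive_quadX (n := 1)).
- by rewrite /profile cb cc /a add0r.
(* Replacing [b] and [c] by their bounds is monotone only while the base of the power is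
   nonnegative. Continuity of that base, itself a profile with exponent 1, keeps it positive near
   the contact point. *)
- have [_ _ _ [jY _] _] := C12_profile x0 1 Da D1 Dc (cst0 _) (cst0 _) ccd.
  have [d d0 Hd] := jY t x Y Y0.
  exists (Num.min d (T / 2)); first by rewrite lt_min d0 divr_gt0.
  move=> s y; rewrite !lt_min => /andP[sd sT] /andP[yd _].
  have := Hd s y sd yd; rewrite /profile cc !expr1 !mul1r /a !add0r -/Y.
  rewrite ltr_norml => /andP[Yt _].
  have {}Yt : 0 < 1 - c s * sqdist x0 y by lra.
  pose sg := T^-1 * (s - t).
  have hsg : `|sg| <= 1 / 2.
    rewrite /sg normrM normfV (gtr0_norm T0) mulrC ler_pdivrMr// ltW//.
    by rewrite mulrC mulrA mulr1.
  have [sg1 sg2] := inv1D_bounds hsg.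
  have TsE : th + s = T * (1 + sg).
    by rewrite mulrDr mulr1 /sg mulrA divff ?gt_eqF// mul1r /T; ring.
  have bE : b s = F t * (1 - al * sg).
    by rewrite /b /quad expr1 /sg; ring.
  have cE : c s = nu / T * (1 - sg + 2 * sg ^+ 2).
    by rewrite /c /quad expr1 /sg; ring.
  have cw : nu / (th + s) <= c s.
    rewrite TsE invfM mulrA cE ler_wpM2l// divr_ge0// ltW//.
  have Yw : 1 - c s * sqdist x0 y <= 1 - nu / (th + s) * sqdist x0 y.
    by rewrite lerD2l lerN2 ler_wpM2r ?sqdist_ge0.
  have FE : F s = F t * (1 + sg) `^ (- al).
    rewrite /F TsE -/T [T * _ / th]mulrAC.
    by rewrite [X in h * X]powRM ?divr_ge0 ?(ltW T0) ?(ltW th0) ?(ltW sg1)// mulrA.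
  have bF : b s <= F s.
    rewrite bE FE ler_wpM2l ?(ltW Ft0)// powRN_ge1B//; lra.
  have Fs0 : 0 < F s by rewrite FE mulr_gt0// powR_gt0.
  apply: (@le_trans _ _ (F s * (1 - c s * sqdist x0 y) ^+ m)).
    by rewrite ler_wpM2r// exprn_ge0// ltW.
  rewrite /w ler_wpM2l ?(ltW Fs0)//; apply: lerXn2r => //; rewrite nnegrE ltW//.
  exact: lt_le_trans Yt Yw.
rewrite (dtime_profile x0 m Da Db Dc) Pkplus_hess_profile//; last first.
  rewrite cb cc -/Y; apply: mulr_ge0; last exact: exprn_ge0 (ltW Y0).
  exact: mulr_ge0 (ltW Ft0) (ler0n _ _).
rewrite cb cc -/Y !quad'_center !expr0 !mul1r.
have mE : m = m.-2.+2 by case: (m) m2 => [|[]].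
have -> : Y ^+ m = Y ^+ m.-2 * Y ^+ 2 by rewrite -exprD addn2 -mE.
have -> : Y ^+ m.-1 = Y ^+ m.-2 * Y by rewrite -exprSr {1}mE.
have sqE : nu * sqdist x0 x = T * (1 - Y).
  by rewrite /Y; field; rewrite gt_eqF.
set Z := Y ^+ m.-2; have Z0 : 0 < Z by rewrite exprn_gt0.
set q := sqdist x0 x in sqE *.
have -> : 0 + F t * (- al / T) * (Z * Y ^+ 2) - F t * (nu / T * - T^-1) * q * m%:R * (Z * Y) =
    F t * Z / T * (- al * Y ^+ 2 + m%:R * (1 - Y) * Y).
  have -> : 1 - Y = nu * q / T by rewrite sqE mulrC mulKf// gt_eqF.
  by field; rewrite gt_eqF.
have -> : -2 * k%:R * F t * (nu / T) * m%:R * (Z * Y) +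
    4 * F t * (nu / T) ^+ 2 * (m * m.-1)%:R * Z * q =
    F t * Z / T * (- (2 * k%:R * (m%:R * nu)) * Y + 4 * nu * (m * m.-1)%:R * (1 - Y)).
  have -> : 1 - Y = nu * q / T by rewrite sqE mulrC mulKf// gt_eqF.
  by field; rewrite gt_eqF.
have FZT0 : 0 <= F t * Z / T by rewrite ltW// divr_gt0// mulr_gt0.
apply: ler_wpM2l FZT0 _ _ _.
have Y1' : 0 <= 1 - Y by lra.
(* Weighting [m_lb] by [1 - Y] and [al_lb] by [Y] leaves exactly the remainder
   [(m + al) (1 - Y)^2 >= 0]. *)
have i1 := ler_wpM2r Y1' m_lb.
have i2 := ler_wpM2r (ltW Y0) al_lb.
have i3 : 0 <= (m%:R + al) * ((1 - Y) * (1 - Y)) by rewrite mulr_ge0 ?mulr_ge0// addr_ge0.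
move: i1 i2 i3; lra.
Qed.

Lemma spreading t x : 0 <= t ->
  h * ((th + t) / th) `^ (- al) * (1 - nu / (th + t) * sqdist x0 x) ^+ m <= u t x.
Proof.
move=> t0; pose t1 := t + 1.
have t10 : 0 <= t1 by rewrite addr_ge0.
pose r := 1 + (th + t1) / nu.
have r1 : 1 <= r by rewrite lerDl divr_ge0 ?addr_ge0// ltW.
apply: (@comparison _ _ k p 0 t1 0 r x0 u w uvisc (lexx _)).
- exact: jcont_clamp_strip.
- have cth : continuous (fun s => th + clamp 0 t1 s).
    by apply: continuous_addf; [exact: cst_continuous | exact: continuous_clamp].
  have th_gt0 s : 0 < th + clamp 0 t1 s.
    by have /andP[h1 _] := clamp_itv s t10; rewrite ltr_pwDl.
  apply: continuous_jcont; rewrite /w; apply: continuous_mulf.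
    apply: (@continuous_fst_comp R N (fun s => F (clamp 0 t1 s))).
    apply: continuous_mulf; first exact: cst_continuous.
    apply: continuous_powRf; last by move=> s; rewrite divr_gt0.
    by apply: continuous_mulf => //; exact: cst_continuous.
  apply: continuous_expf; apply: continuous_addf; first exact: cst_continuous.
  apply: continuous_oppf; apply: continuous_mulf.
    apply: (@continuous_fst_comp R N (fun s => nu / (th + clamp 0 t1 s))).
    apply: continuous_mulf; first exact: cst_continuous.
    by apply: continuous_invf => // s; rewrite gt_eqF.
  exact: (continuous_snd_comp (@continuous_sqdist _ _ x0)).
- move=> y; have [sq|sq] := ltP (sqdist x0 y) (th / nu).
    apply: le_trans (u_init sq); rewrite /w /F addr0 divff ?gt_eqF// powR1 mulr1.
    rewrite -[leRHS]mulr1 ler_wpM2l ?(ltW h0)//.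
    have hY : nu / th * sqdist x0 y <= 1.
      by rewrite mulrAC ler_pdivrMr// mul1r mulrC -ler_pdivlMr// ltW.
    by rewrite exprn_ile1 ?subr_ge0// gerBl mulr_ge0 ?sqdist_ge0// divr_ge0// ltW.
  by apply: le_trans (u_ge0 y (lexx _)); apply: w_le0; rewrite ?addr0.
- move=> s y /andP[s0 s1] ry; apply: le_trans (u_ge0 y s0); apply: w_le0 => //.
  apply: le_trans (normsq_le_sqdist x0 y).
  have y1 : 1 <= `|y - x0| by apply: le_trans ry.
  apply: (@le_trans _ _ `|y - x0|); last by rewrite expr2 ler_peMl.
  apply: le_trans ry; apply: (@le_trans _ _ ((th + t1) / nu)); last by rewrite lerDr.
  by rewrite ler_wpM2r ?invr_ge0 ?(ltW nu0)// lerD2l.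
- move=> s y /andP[s0 s1] uw.
  have wpos : 0 < w s y := le_lt_trans (u_ge0 y (ltW s0)) uw.
  have [phi [h1 h2 h3 h4]] := w_test s0 wpos.
  exists phi; split => //; apply: le_trans h4 _; rewrite mul0r addr0 lerDl.
  exact: nonlin_ge0.
- by rewrite t0 ltrDl ltr01.
Qed.

End Spreading.

(** * Choice of the parameters and conclusion *)

Theorem mainTheorem6 (R : realType) (N k : nat) (p : R) (u0 : 'rV[R]_N -> R) :
  (2 <= N)%N -> (1 <= k)%N -> (k < N)%N ->
  0 < p -> p < 2 / k%:R ->
  unif_cont u0 -> (forall x, 0 <= u0 x) -> (exists x, u0 x != 0) ->
  ~ (exists u : R -> 'rV[R]_N -> R, global_solution k p u0 u).
Proof.
move=> _ k1 /ltnW kN p0 pk cu0 u0_ge0 [z u0z] [u [uinit ustrip uvisc]].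
have u_ge0 : forall (t : R) x, 0 <= t -> 0 <= u t x.
  move=> t x t0; apply: (supersolution_ge0 k1 kN uvisc ustrip _ _ t0) => y.
  by rewrite uinit.
have k0 : 0 < k%:R :> R by rewrite ltr0n.
have kp : k%:R * p < 2 by rewrite mulrC -ltr_pdivlMr.
(* The midpoint of [k / 2] and [1 / p]; this is where [p < 2 / k] is used. *)
pose al : R := (k%:R / 2 + p^-1) / 2.
have pV0 : 0 < p^-1 by rewrite invr_gt0.
have kpV : k%:R / 2 < p^-1 by rewrite -[p^-1]mul1r ltr_pdivlMr//; lra.
have al_k : k%:R / 2 < al by rewrite /al; lra.
have al0 : 0 < al by apply: lt_trans al_k; rewrite divr_gt0.
have al_p : al * p < 1.
  by rewrite -ltr_pdivlMr// mul1r /al; lra.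
(* The surplus of [al] over [k / 2]. With the [nu] below, [al_lb] is an equality and [m_lb] becomes
   [1 + al <= eta (m - 1)], which holds for [m] large. *)
pose eta := 2 * al / k%:R - 1.
have eta0 : 0 < eta by rewrite subr_gt0 ltr_pdivlMr//; lra.
have [l Hl] : exists l : nat, (1 + al) / eta <= l%:R.
  by exists (Num.truncn ((1 + al) / eta)).+1; rewrite ltW// truncnS_gt.
have [m [m_odd m2 lm']] : exists m : nat, [/\ odd m, (2 <= m)%N & (l <= m.-1)%N].
  exists (l.*2.+3); split => //=; first by rewrite odd_double.
  by rewrite -addnn -addn2 -addnA leq_addr.
have m0 : 0 < m%:R :> R by rewrite ltr0n; exact: ltnW.
pose nu := al / (2 * k%:R * m%:R).
have nu0 : 0 < nu by rewrite divr_gt0// mulr_gt0// mulr_gt0.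
have al_lb : 2 * k%:R * (m%:R * nu) <= al.
  have -> : 2 * k%:R * (m%:R * nu) = al by rewrite /nu; field; rewrite !gt_eqF.
  exact: lexx.
have m_lb : m%:R + al <= 4 * nu * (m * m.-1)%:R.
  have -> : 4 * nu * (m * m.-1)%:R = (1 + eta) * m.-1%:R.
    by rewrite natrM /nu /eta; field; rewrite !gt_eqF.
  rewrite (_ : m%:R = 1 + m.-1%:R :> R); last by rewrite nat1r prednK// ltnW.
  have lm : (l%:R : R) <= m.-1%:R by rewrite ler_nat.
  have : 1 + al <= eta * m.-1%:R.
    by rewrite mulrC -ler_pdivrMr// (le_trans Hl).
  lra.
pose h := u0 z / 2.
have u0z0 : 0 < u0 z by rewrite lt_neqAle eq_sym u0z u0_ge0.
have h0 : 0 < h by rewrite divr_gt0.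
have [d d0 Hd] := cu0 h h0.
(* Then [th / nu = d ^+ 2]: the initial bump is supported where [u0] stays above [h]. *)
pose th := nu * d ^+ 2.
have th0 : 0 < th by rewrite mulr_gt0// exprn_gt0.
have u_init x : sqdist z x < th / nu -> h <= u 0 x.
  rewrite /th mulrAC divff ?gt_eqF// mul1r => sq; rewrite uinit.
  have : `|x - z| < d.
    rewrite -(@ltr_pXn2r _ 2) ?nnegrE ?(ltW d0)//.
    exact: le_lt_trans (normsq_le_sqdist z x) sq.
  by move=> /Hd; rewrite ltr_norml /h => /andP[? _]; lra.
have spread := spreading k1 kN uvisc ustrip u_ge0 m_odd m2 (ltW al0) nu0 th0 h0 al_lb m_lb u_init.
have [n np] : exists n : nat, 1 <= n%:R * p.
  by exists (Num.truncn p^-1).+1; rewrite -ler_pdivrMr// mul1r ltW// truncnS_gt.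
pose K := n.+1%:R * (2 * n.+1%:R) `^ p.
pose A := h * (2^-1) ^+ m.
have A0 : 0 < A by rewrite mulr_gt0// exprn_gt0.
pose D := A `^ p * (th / (8 * k%:R * nu)).
have kn0 : 0 < 8 * k%:R * nu by rewrite mulr_gt0// mulr_gt0.
have D0 : 0 < D by rewrite /D mulr_gt0 ?powR_gt0// divr_gt0.
have K0 : 0 < K by rewrite /K mulr_gt0 ?ltr0Sn// powR_gt0 ?mulr_gt0 ?ltr0Sn.
pose gam := 1 - al * p; have gam0 : 0 < gam by rewrite subr_gt0.
(* [X] is the ratio [(th + t) / th]. The size condition of the paraboloid reads
   [K <= g ^ p * tau = D * X ^ gam], and [gam = 1 - al p > 0] lets a late time satisfy it. *)
pose X := 1 + (K / D) `^ gam^-1.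
have X1 : 1 <= X by rewrite lerDl powR_ge0.
have X0 : 0 < X by exact: lt_le_trans X1.
have XK : K <= X `^ gam * D.
  rewrite -ler_pdivrMr// -[leLHS]powRr1; last by rewrite divr_ge0// ltW.
  rewrite -[X in _ `^ X](@mulVf _ gam) ?gt_eqF// powRrM.
  by rewrite ge0_ler_powR ?nnegrE ?(ltW gam0) ?powR_ge0 ?(ltW X0)// lerDr.
pose t := th * (X - 1).
have t0 : 0 <= t by rewrite mulr_ge0 ?subr_ge0// ltW.
have TE : th + t = th * X by rewrite /t; ring.
(* On the ball [|x - z|^2 <= 4 k tau] the base of the spreading profile is then at least [1 / 2],
   whence the factor [2^-m] in [A]. *)
pose tau := th * X / (8 * k%:R * nu).
have tau0 : 0 < tau by rewrite divr_gt0// mulr_gt0.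
pose g := A * X `^ (- al).
have g0 : 0 < g by rewrite mulr_gt0// powR_gt0.
apply: (large_data_blowup k1 kN p0 uvisc ustrip u_ge0 (n := n) (t0 := t) (tau := tau) (g := g) (x0 := z)) => //.
- rewrite -/K (le_trans XK)// /g powRM ?(ltW A0) ?powR_ge0// -powRrM.
  have -> : X `^ gam = X `^ (- al * p) * X.
    rewrite -[X in _ = _ * X]powRr1 ?(ltW X0)// -powRD ?(gt_eqF X0) ?implybT//.
    by congr (_ `^ _); rewrite /gam; ring.
  by rewrite /D /tau le_eqVlt; apply/orP; left; apply/eqP; ring.
- move=> x sq; apply: le_trans (spread t x t0); rewrite TE.
  have -> : th * X / th = X by rewrite mulrAC divff ?mul1r// gt_eqF.
  rewrite /g /A mulrAC ler_wpM2l ?mulr_ge0 ?powR_ge0 ?(ltW h0)//.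
  have hY : 2^-1 <= 1 - nu / (th * X) * sqdist z x.
    have : nu / (th * X) * sqdist z x <= nu / (th * X) * (4 * k%:R * tau).
      by rewrite ler_wpM2l// divr_ge0 ?(ltW nu0)// mulr_ge0 ?(ltW th0) ?(ltW X0).
    have -> : nu / (th * X) * (4 * k%:R * tau) = 2^-1.
      by rewrite /tau; field; rewrite !gt_eqF.
    lra.
  apply: lerXn2r => //; rewrite nnegrE ?invr_ge0//.
  by apply: le_trans hY; rewrite invr_ge0.
Qed.
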